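(* Let $K$ be a field, let $A$ and $B$ be Morita equivalent finitely generated $K$-algebras, and let $\begin{pmatrix} A & X\\ Y & B\end{pmatrix}$ be a Morita context that provides the Morita equivalence, i.e. ${}_AX_B$ and ${}_BY_A$ are bimodules with $XY=A$ and $YX=B$. Then, for each finitely generated $A$-module $M$, $$\operatorname{GK}({}_AM)=\operatorname{GK}({}_B(Y\otimes_A M)).$$
   Context: Algebras are associative unital $K$-algebras; modules are left modules. In a Morita context (of $K$-algebras), $XY\subseteq A$ and $YX\subseteq B$ denote the images of the multiplication bimodule maps $X\otimes_B Y\to A$ and $Y\otimes_A X\to B$. The bimodules $X$ and $Y$ are then necessarily finitely generated on each side. $\operatorname{GK}$ is the Gelfand-Kirillov dimension: if $A$ is generated by $a_1,\dots,a_s$, put $A_0:=K$, $A_1:=K+\sum_j Ka_j$, $A_i:=A_1^i$, and for $M=AM_0$ with $M_0$ a finite dimensional generating subspace put $M_i:=A_iM_0$; then $\operatorname{GK}({}_AM)=\gamma(i\mapsto\dim_K M_i)$, where $\gamma(f)=\inf\{r\in\mathbb{R}\mid f(i)\le i^r\text{ for } i\gg 0\}$ (with $\inf\emptyset=\infty$); similarly for $B$-modules. *)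

(* Defs.v *)
From HB Require Import structures.
From mathcomp Require Import all_boot all_order all_algebra.
From mathcomp Require Import all_classical all_reals all_analysis.
From mathcomp Require Import freeg.

Set Implicit Arguments.
Unset Strict Implicit.
Unset Printing Implicit Defensive.

Import Order.TTheory GRing.Theory Num.Theory.
Local Open Scope classical_set_scope.
Local Open Scope ring_scope.
Local Open Scope quotient_scope.

(* An associative unital K-algebra, as a ring A with a morphism from K to its  *)
(* center. MathComp's algType requires 1 != 0; here A may be the zero algebra. *)
Record kalgType (K : fieldType) := KAlg {
  kalg_ring :> pzRingType;
  kalg_map : {rmorphism K -> kalg_ring};
  kalg_central : forall k x, kalg_map k * x = x * kalg_map k
}.

Definition kalg_of_algType (K : fieldType) (A : algType K) : kalgType K :=
  @KAlg K A (in_alg A) (fun k x => etrans (mulr_algl k x) (esym (mulr_algr k x))).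

Section LinearSpan.
Variables (R : pzRingType) (V : lmodType R).

Definition lspan (S : set V) : set V :=
  [set v | exists n (c : 'I_n -> R) (s : 'I_n -> V),
     (forall i, S (s i)) /\ v = \sum_(i < n) c i *: s i].

Definition lin_indep n (v : 'I_n -> V) : Prop :=
  forall c : 'I_n -> R, \sum_(i < n) c i *: v i = 0 -> forall i, c i = 0.

Definition is_basis n (v : 'I_n -> V) (W : set V) : Prop :=
  lin_indep v /\ W = lspan (range v).

Definition fin_dim_space (W : set V) : Prop :=
  exists n (v : 'I_n -> V), is_basis v W.

(* The value 0 on subspaces that are not finite dimensional is irrelevant. *)
Definition ldim (W : set V) : nat :=
  xget 0%N [set n | exists v : 'I_n -> V, is_basis v W].

Lemma lspan0 (S : set V) : lspan S 0.
Proof.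
by exists 0%N, (fun=> 0), (fun=> 0); split=> [[]//|]; rewrite big_ord0.
Qed.

Lemma lspan_gen (S : set V) v : S v -> lspan S v.
Proof.
by move=> Sv; exists 1%N, (fun=> 1), (fun=> v); rewrite big_ord1 scale1r.
Qed.

Lemma lspanD (S : set V) u v : lspan S u -> lspan S v -> lspan S (u + v).
Proof.
move=> [m [c [s [Ss ->]]]] [n [d [t [St ->]]]].
pose pick (T : Type) (f : 'I_m -> T) (g : 'I_n -> T) (i : 'I_(m + n)) :=
  match fintype.split i with inl j => f j | inr j => g j end.
exists (m + n)%N, (pick _ c d), (pick _ s t); split.
  by move=> i; rewrite /pick; case: (fintype.split i).
rewrite big_split_ord /=; congr (_ + _); apply: eq_bigr => i _.
  by rewrite /pick (unsplitK (inl i)).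
by rewrite /pick (unsplitK (inr i)).
Qed.

Lemma lspanZ (S : set V) a v : lspan S v -> lspan S (a *: v).
Proof.
move=> [m [c [s [Ss ->]]]]; exists m, (fun i => a * c i), s; split=> //.
by rewrite scaler_sumr; apply: eq_bigr => i _; rewrite scalerA.
Qed.

Lemma lspanB (S : set V) u v : lspan S u -> lspan S v -> lspan S (u - v).
Proof. by move=> Su Sv; rewrite -scaleN1r; apply/lspanD/lspanZ. Qed.

Lemma lspan_sum (S : set V) n (F : 'I_n -> V) :
  (forall i, lspan S (F i)) -> lspan S (\sum_(i < n) F i).
Proof.
move=> SF; elim/big_ind: _ => // [|u v]; first exact: lspan0.
exact: lspanD.
Qed.

End LinearSpan.

Definition restrict_scalars (K : fieldType) (A : kalgType K)
  (M : lmodType A) : Type := M.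

Section RestrictScalars.
Variables (K : fieldType) (A : kalgType K) (M : lmodType A).

HB.instance Definition _ := GRing.Zmodule.on (restrict_scalars M).

Definition restr_scale (k : K) (m : restrict_scalars M) : restrict_scalars M :=
  kalg_map A k *: (m : M).

Fact restr_scaleA a b m :
  restr_scale a (restr_scale b m) = restr_scale (a * b) m.
Proof. by rewrite /restr_scale scalerA rmorphM. Qed.

Fact restr_scale1 : left_id 1 restr_scale.
Proof. by move=> m; rewrite /restr_scale rmorph1; exact: scale1r. Qed.

Fact restr_scaleDr : right_distributive restr_scale +%R.
Proof. by move=> a u v; exact: scalerDr. Qed.

Fact restr_scaleDl m : {morph restr_scale^~ m : a b / a + b}.
Proof. by move=> a b; rewrite /restr_scale rmorphD; exact: scalerDl. Qed.

HB.instance Definition _ := GRing.Zmodule_isLmodule.Build K (restrict_scalars M)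
  restr_scaleA restr_scale1 restr_scaleDr restr_scaleDl.

End RestrictScalars.

Section FinitelyGenerated.
Variables (K : fieldType) (A : kalgType K).

(* A as a K-vector space *)
Definition kalg_space := restrict_scalars (A^o : lmodType A).

(* No proper K-subalgebra of A contains all the elements of a. *)
Definition alg_generated_by (a : seq A) : Prop :=
  forall S : set A,
    (forall k : K, S (kalg_map A k)) ->
    (forall x y, S x -> S y -> S (x - y)) ->
    (forall x y, S x -> S y -> S (x * y)) ->
    [set` a] `<=` S -> S = setT.

Definition fg_algebra : Prop := exists a : seq A, alg_generated_by a.

Definition fg_module (M : lmodType A) : Prop :=
  exists s : seq M, lspan [set` s] = setT.

(* A_1 = K + \sum_j K a_j *)
Definition filt1 (a : seq A) : set kalg_space :=
  lspan [set x : kalg_space | x = 1 :> A \/ (x : A) \in a].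

(* A_i = A_1 ^ i, with A_0 = K; products of subspaces are spans of products. *)
Fixpoint filt (a : seq A) (i : nat) : set kalg_space :=
  if i is j.+1 then
    lspan [set z : kalg_space | exists x y,
             [/\ filt1 a x, filt a j y & z = (x : A) * (y : A)]]
  else lspan [set z : kalg_space | z = 1 :> A].

(* M_i = A_i M_0 *)
Definition mod_filt (M : lmodType A) (a : seq A)
    (M0 : set (restrict_scalars M)) (i : nat) : set (restrict_scalars M) :=
  lspan [set z : restrict_scalars M | exists x m,
           [/\ filt a i x, M0 m & z = (x : A) *: (m : M)]].

End FinitelyGenerated.

Definition growth (R : realType) (f : nat -> nat) : \bar R :=
  ereal_inf [set r%:E | r in
    [set r : R | \forall i \near \oo, (f i)%:R <= (i%:R : R) `^ r]].

(* g is the growth of i |-> dim_K M_i for some finite generating sequence of A *)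
(* and some finite dimensional subspace M_0 with M = A M_0.                    *)
Definition is_GKdim (R : realType) (K : fieldType) (A : kalgType K)
    (M : lmodType A) (g : \bar R) : Prop :=
  exists (a : seq A) (M0 : set (restrict_scalars M)),
    [/\ alg_generated_by a, fin_dim_space M0, lspan (M0 : set M) = setT &
        g = growth R (fun i => ldim (mod_filt a M0 i))].

(* The value of growth does not depend on the generators of A and on M_0; the *)
(* default +oo is taken only when A or M is not finitely generated.           *)
Definition GKdim (R : realType) (K : fieldType) (A : kalgType K)
    (M : lmodType A) : \bar R :=
  xget +oo%E [set g | is_GKdim M g].

Record bimodType (K : fieldType) (A B : kalgType K) := Bimod {
  bimod_sort :> lmodType A;
  rscale : bimod_sort -> B -> bimod_sort;
  rscaleDl : forall x y b, rscale (x + y) b = rscale x b + rscale y b;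
  rscaleDr : forall x b c, rscale x (b + c) = rscale x b + rscale x c;
  rscaleA : forall x b c, rscale (rscale x b) c = rscale x (b * c);
  rscale1 : forall x, rscale x 1 = x;
  lrscaleA : forall a x b, rscale (a *: x) b = a *: rscale x b;
  (* K acts in the same way on both sides *)
  lrscaleK : forall (k : K) x, rscale x (kalg_map B k) = kalg_map A k *: x
}.

Section Tensor.
Variables (K : fieldType) (A B : kalgType K).
Variables (Y : bimodType B A) (M : lmodType A).

Definition free_tens := {freeg (Y * M)%type / int}.
Definition gen_tens (y : Y) (m : M) : free_tens := << (y, m) >>.

Definition tens_relator : set free_tens := [set D |
  [\/ exists y y' m, D = gen_tens (y + y') m - gen_tens y m - gen_tens y' m,
      exists y m m', D = gen_tens y (m + m') - gen_tens y m - gen_tens y m' |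
      exists y a m, D = gen_tens (rscale y a) m - gen_tens y (a *: m)]].

Definition tens_rel : {pred free_tens} := fun D => `[< lspan tens_relator D >].

Fact tens_rel_zmod_closed : zmod_closed tens_rel.
Proof.
split; first by apply/asboolP; exact: lspan0.
by move=> u v /asboolP Su /asboolP Sv; apply/asboolP; exact: lspanB.
Qed.
HB.instance Definition _ :=
  GRing.isZmodClosed.Build free_tens tens_rel tens_rel_zmod_closed.

Definition tensor : Type := {ideal_quot tens_rel}.
HB.instance Definition _ := GRing.Zmodule.on tensor.

Implicit Types (y : Y) (m : M) (b : B).

Definition tens_proj (D : free_tens) : tensor := \pi_{ideal_quot tens_rel} D.

Definition tens y m : tensor := tens_proj (gen_tens y m).

Fact tens_projD D1 D2 : tens_proj (D1 + D2) = tens_proj D1 + tens_proj D2.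
Proof. exact: (raddfD \pi_{ideal_quot tens_rel}). Qed.

Fact tens_proj_repr (t : tensor) : tens_proj (repr t) = t.
Proof. exact: reprK. Qed.

Fact tens_proj_eq D1 D2 :
  lspan tens_relator (D1 - D2) <-> tens_proj D1 = tens_proj D2.
Proof.
have e := Quotient.idealrBE tens_rel D1 D2.
split=> [h|/eqP h]; first by apply/eqP; rewrite -[_ == _]e; apply/asboolP.
by apply/asboolP; rewrite -[X in is_true X]/(D1 - D2 \in tens_rel) e.
Qed.

(* b (y (x) m) = (b y) (x) m *)
Definition free_scale b : free_tens -> free_tens :=
  fglift (fun p : Y * M => gen_tens (b *: p.1) p.2).

Definition tensor_scale b (t : tensor) : tensor :=
  tens_proj (free_scale b (repr t)).

Fact free_scaleB b : {morph free_scale b : D E / D - E}.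
Proof. exact: lift_is_additive. Qed.

Fact free_scale0 b : free_scale b 0 = 0.
Proof. by rewrite -[X in free_scale b X](subrr 0) free_scaleB subrr. Qed.

Fact free_scaleN b D : free_scale b (- D) = - free_scale b D.
Proof. by rewrite -sub0r free_scaleB free_scale0 sub0r. Qed.

Fact free_scaleD b : {morph free_scale b : D E / D + E}.
Proof.
by move=> D E; rewrite -[X in free_scale b (_ + X)]opprK free_scaleB free_scaleN opprK.
Qed.

Fact free_scale_gen b y m : free_scale b (gen_tens y m) = gen_tens (b *: y) m.
Proof. by rewrite /free_scale /gen_tens liftU scale1r. Qed.

Fact free_scaleZ b (c : int) D : free_scale b (c *: D) = c *: free_scale b D.
Proof.
have scaleN (n : nat) (E : free_tens) : (Posz n) *: E = E *+ n.
  elim: n => [|n IH]; first by rewrite scale0r.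
  by rewrite mulrSr -IH -addn1 PoszD scalerDl scale1r.
have scaleMn n E : free_scale b (E *+ n) = free_scale b E *+ n.
  elim: n => [|n IH]; first by rewrite free_scale0.
  by rewrite !mulrSr free_scaleD IH.
case: c => n; first by rewrite !scaleN scaleMn.
by rewrite NegzE !scaleNr free_scaleN !scaleN scaleMn.
Qed.

Fact free_scale_rel b D :
  lspan tens_relator D -> lspan tens_relator (free_scale b D).
Proof.
move=> [n [c [s [Rs ->]]]].
rewrite (big_morph _ (free_scaleD b) (free_scale0 b)).
apply: lspan_sum => i; rewrite free_scaleZ; apply/lspanZ/lspan_gen.
have [[y [y' [m ->]]]|[y [m [m' ->]]]|[y [a [m ->]]]] := Rs i;
  rewrite !free_scaleB !free_scale_gen.
- by apply: Or31; exists (b *: y), (b *: y'), m; rewrite scalerDr.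
- by apply: Or32; exists (b *: y), m, m'.
- by apply: Or33; exists (b *: y), a, m; rewrite lrscaleA.
Qed.

Fact tensor_scale_proj b D :
  tensor_scale b (tens_proj D) = tens_proj (free_scale b D).
Proof.
apply/tens_proj_eq; rewrite -free_scaleB; apply: free_scale_rel.
by apply/tens_proj_eq; rewrite tens_proj_repr.
Qed.

Fact tensorP (P : tensor -> Prop) : (forall D, P (tens_proj D)) -> forall t, P t.
Proof. by move=> PD t; rewrite -[t]tens_proj_repr. Qed.

Fact tensor_scaleDr : right_distributive tensor_scale +%R.
Proof.
move=> b; apply: tensorP => D; apply: tensorP => E.
by rewrite -tens_projD !tensor_scale_proj free_scaleD tens_projD.
Qed.


Fact tens_projN D : tens_proj (- D) = - tens_proj D.
Proof. exact: (raddfN \pi_{ideal_quot tens_rel}). Qed.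

Fact tens_ind (P : tensor -> Prop) :
  P 0 -> (forall y m, P (tens y m)) -> (forall t u, P t -> P u -> P (t - u)) ->
  forall t, P t.
Proof.
move=> P0 Pgen PB; have PN t : P t -> P (- t) by rewrite -sub0r; exact: PB.
have PD t u : P t -> P u -> P (t + u).
  by move=> Pt Pu; rewrite -[u]opprK; apply: PB => //; exact: PN.
apply: tensorP => D; rewrite -[D]freeg_sumE.
elim: (dom D) => [|[y m] s IH].
  by rewrite big_nil; have -> : tens_proj 0 = 0 by exact: (raddf0 \pi_{ideal_quot tens_rel}).
rewrite big_cons tens_projD; apply: (PD) => //.
set k := coeff _ _.
have Pn n : P (tens_proj << Posz n *g (y, m) >>).
  elim: n => [|n IHn].
    by rewrite freegU0; have -> : tens_proj 0 = 0 by exact: (raddf0 \pi_{ideal_quot tens_rel}).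
  by rewrite -addn1 PoszD -freegUD tens_projD; apply: (PD) => //; exact: Pgen.
case: k => n //; rewrite NegzE -freegUN tens_projN; exact: PN.
Qed.

Fact tensor_scale_tens b y m : tensor_scale b (tens y m) = tens (b *: y) m.
Proof. by rewrite tensor_scale_proj free_scale_gen. Qed.

Fact tensor_scaleB b t u :
  tensor_scale b (t - u) = tensor_scale b t - tensor_scale b u.
Proof.
by apply/eqP; rewrite eq_sym subr_eq -tensor_scaleDr subrK.
Qed.

Fact tensor_scale0 b : tensor_scale b 0 = 0.
Proof. by rewrite -[X in tensor_scale b X](subrr 0) tensor_scaleB subrr. Qed.

Fact tensDl y y' m : tens (y + y') m = tens y m + tens y' m.
Proof.
rewrite /tens -tens_projD; apply/tens_proj_eq/lspan_gen/Or31.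
by exists y, y', m; rewrite opprD addrA.
Qed.

Fact tensDr y m m' : tens y (m + m') = tens y m + tens y m'.
Proof.
rewrite /tens -tens_projD; apply/tens_proj_eq/lspan_gen/Or32.
by exists y, m, m'; rewrite opprD addrA.
Qed.

Fact tens_balanced y (a : A) m : tens (rscale y a) m = tens y (a *: m).
Proof. by apply/tens_proj_eq/lspan_gen/Or33; exists y, a, m. Qed.

Fact tensor_scaleA b c t :
  tensor_scale b (tensor_scale c t) = tensor_scale (b * c) t.
Proof.
elim/tens_ind: t => [|y m|t u IHt IHu]; first by rewrite !tensor_scale0.
  by rewrite !tensor_scale_tens scalerA.
by rewrite !tensor_scaleB IHt IHu.
Qed.

Fact tensor_scale1 : left_id 1 tensor_scale.
Proof.
elim/tens_ind => [|y m|t u IHt IHu]; first by rewrite tensor_scale0.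
  by rewrite tensor_scale_tens scale1r.
by rewrite tensor_scaleB IHt IHu.
Qed.

Fact tensor_scaleDl t : {morph tensor_scale^~ t : b c / b + c}.
Proof.
move=> b c; elim/tens_ind: t => [|y m|t u IHt IHu].
- by rewrite !tensor_scale0 addr0.
- by rewrite !tensor_scale_tens scalerDl tensDl.
- by rewrite !tensor_scaleB IHt IHu opprD addrACA.
Qed.

HB.instance Definition _ := GRing.Zmodule_isLmodule.Build B tensor
  tensor_scaleA tensor_scale1 tensor_scaleDr tensor_scaleDl.

End Tensor.

(* The bimodule maps X (x)_B Y -> A and Y (x)_A X -> B are given as balanced  *)
(* biadditive maps mcXY and mcYX; associativity of the matrix ring amounts to *)
(* mcXYX and mcYXY together with the bimodule and balancing identities.       *)
Record morita_context (K : fieldType) (A B : kalgType K)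
    (X : bimodType A B) (Y : bimodType B A) := MoritaContext {
  mcXY : X -> Y -> A;
  mcYX : Y -> X -> B;
  mcXYDl : forall x x' y, mcXY (x + x') y = mcXY x y + mcXY x' y;
  mcXYDr : forall x y y', mcXY x (y + y') = mcXY x y + mcXY x y';
  mcXY_bal : forall x b y, mcXY (rscale x b) y = mcXY x (b *: y);
  mcXY_l : forall a x y, mcXY (a *: x) y = a * mcXY x y;
  mcXY_r : forall x y a, mcXY x (rscale y a) = mcXY x y * a;
  mcYXDl : forall y y' x, mcYX (y + y') x = mcYX y x + mcYX y' x;
  mcYXDr : forall y x x', mcYX y (x + x') = mcYX y x + mcYX y x';
  mcYX_bal : forall y a x, mcYX (rscale y a) x = mcYX y (a *: x);
  mcYX_l : forall b y x, mcYX (b *: y) x = b * mcYX y x;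
  mcYX_r : forall y x b, mcYX y (rscale x b) = mcYX y x * b;
  mcXYX : forall x y x', mcXY x y *: x' = rscale x (mcYX y x');
  mcYXY : forall y x y', mcYX y x *: y' = rscale y (mcXY x y')
}.

(* The images XY of X (x)_B Y -> A and YX of Y (x)_A X -> B. *)
Definition imXY (K : fieldType) (A B : kalgType K) (X : bimodType A B)
    (Y : bimodType B A) (C : morita_context X Y) : set A :=
  [set a | exists s : seq (X * Y), a = \sum_(p <- s) mcXY C p.1 p.2].
Definition imYX (K : fieldType) (A B : kalgType K) (X : bimodType A B)
    (Y : bimodType B A) (C : morita_context X Y) : set B :=
  [set b | exists s : seq (Y * X), b = \sum_(p <- s) mcYX C p.1 p.2].

Definition morita_equivalence (K : fieldType) (A B : kalgType K)
    (X : bimodType A B) (Y : bimodType B A) (C : morita_context X Y) : Prop :=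
  imXY C = setT /\ imYX C = setT.

(* Main.v *)
Require Import Defs.
From mathcomp Require Import all_boot all_order all_algebra.
From mathcomp Require Import all_classical all_reals all_analysis.
From mathcomp Require Import freeg zify.

(* A resolution 1 = sum_p x_p y_p of the unit of A = XY moves the filtration  *)
(* of M into that of N = Y (x) M: every y_p u equals sum_q (y_p u x_q) y_q    *)
(* with y_p u x_q in B, so, by induction on i, y_p A_i M_0 is contained in    *)
(* N_(c i + d) for some constants c and d. Hence m = sum_p x_p (y_p m) gives  *)
(* dim M_i <= s dim N_(c i + d), where s is the number of terms, and affine   *)
(* changes of the index and constant factors do not raise the growth. The     *)
(* converse inequality is the same one for the Morita context with A and B    *)
(* exchanged, since x (y (x) m) = (x y) m makes M and N play symmetric roles. *)

Set Implicit Arguments.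
Unset Strict Implicit.
Unset Printing Implicit Defensive.

Import Order.TTheory GRing.Theory Num.Theory.
Local Open Scope classical_set_scope.
Local Open Scope ring_scope.

(** Both inequalities are instances of [is_GKdim_le], which compares arbitrary generating data on
    the two sides and so applies to the values that [GKdim] selects. Its core is the filtration
    estimate [actY_filt], turned into a comparison of growths by [growth_le_affine]. The reverse
    inequality comes from [morita_pair_sym], and [tensor_pair] shows that M and Y (x) M form a
    symmetric pair. Since [GKdim] has a default value, [is_GKdim_ex] and [morita_pair_fg] are there
    to ensure that genuine values are compared. *)

(** * Growth under affine changes of the index *)

(** An exponent r for g yields r + e for f, for every e > 0, since i^e eventually exceeds any
    constant. Positivity of c keeps c i + d at least i, where the bound on g holds. *)
Lemma growth_le_affine (R : realType) (f g : nat -> nat) (p c d : nat) :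
  (0 < c)%N -> (forall i, f i <= p * g (c * i + d))%N ->
  (growth R f <= growth R g)%E.
Proof.
move=> c_gt0 fg; apply/ereal_infP => _ [r [N _ gN] <-].
apply/lee_addgt0Pr => e e_gt0; apply: ereal_inf_lbound; exists (r + e) => //=.
(* The maximum covers both signs of r: (c i + d)^r is at most ((c + d) i)^r for r >= 0, and at most
   i^r for r < 0. *)
pose C : R := Num.max 1 ((c + d)%:R `^ r).
have C_ge0 : 0 <= C by rewrite le_max ler01.
pose D : R := p%:R * C.
have D_ge0 : 0 <= D by rewrite mulr_ge0.
(* Beyond D^(1/e) the factor i^e absorbs the constant D. *)
have [N' _ DN'] := nbhs_infty_ger (D `^ e^-1).
exists (maxn N (maxn N' 1)) => // i /=.
rewrite !geq_max => /and3P[Ni N'i i_gt0].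
have i_neq0 : i%:R != 0 :> R by rewrite pnatr_eq0 -lt0n.
have ci_pos : (0 < c * i + d)%N by nia.
have De : D <= i%:R `^ e.
  have <- : (D `^ e^-1) `^ e = D by rewrite -powRrM mulVf ?lt0r_neq0 ?powRr1.
  apply: ge0_ler_powR; rewrite ?nnegrE ?powR_ge0 ?ler0n ?(ltW e_gt0) //.
  exact: (DN' i N'i).
have affC : (c * i + d)%:R `^ r <= C * i%:R `^ r :> R.
  have [r_ge0|r_lt0] := leP 0 r.
    apply: (@le_trans _ _ (((c + d) * i)%:R `^ r)).
      by apply: ge0_ler_powR; rewrite ?nnegrE ?ler0n // ler_nat; nia.
    by rewrite natrM powRM // ler_wpM2r ?powR_ge0 // le_max lexx orbT.
  apply: (@le_trans _ _ (i%:R `^ r)); last first.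
    by rewrite ler_peMl ?powR_ge0 // le_max lexx.
  rewrite -[r]opprK !(powRN _ (- r)) lef_pV2 ?posrE ?powR_gt0 ?ltr0n //.
  apply: ge0_ler_powR; rewrite ?nnegrE ?ler0n ?oppr_ge0 ?(ltW r_lt0) //.
  by rewrite ler_nat; nia.
apply: (@le_trans _ _ (p%:R * (g (c * i + d)%N)%:R)).
  by rewrite -natrM ler_nat.
have g_le : (g (c * i + d)%N)%:R <= (c * i + d)%:R `^ r :> R.
  by apply: gN => /=; nia.
apply: (le_trans (ler_wpM2l (ler0n _ p) (le_trans g_le affC))).
rewrite mulrA powRD ?i_neq0 ?implybT // mulrC.
by apply: ler_wpM2l => //; exact: powR_ge0.
Qed.

(** * Spans and dimensions *)

(** Reduces inclusions of spans to generators. The map [f] is a bare function because most maps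
    below are K-linear only after restriction of scalars. *)
Lemma lspan_morph (R : pzRingType) (V W : lmodType R) (f : V -> W)
    (S : set V) (T : set W) :
  {morph f : u v / u + v} -> (forall k, {morph f : v / k *: v}) ->
  (forall v, S v -> lspan T (f v)) -> forall v, lspan S v -> lspan T (f v).
Proof.
move=> fD fZ fS _ [n [c [s [Ss ->]]]].
have f0 : f 0 = 0 by rewrite -(scale0r (0 : V)) fZ scale0r.
rewrite (big_morph f fD f0); apply: lspan_sum => i.
by rewrite fZ; apply/lspanZ/fS.
Qed.

Lemma lspan_sub (R : pzRingType) (V : lmodType R) (S T : set V) :
  S `<=` lspan T -> lspan S `<=` lspan T.
Proof. by move=> ST; apply: (@lspan_morph _ _ _ id). Qed.

Lemma lspan_range (R : pzRingType) (V : lmodType R) n (v : 'I_n -> V) w :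
  lspan (range v) w -> exists c : 'I_n -> R, w = \sum_(i < n) c i *: v i.
Proof.
move=> [m [c [s [sv ->]]]].
have /boolp.choice[j sE] (i : 'I_m) : exists k, s i = v k.
  by have [k _ <-] := sv i; exists k.
exists (fun k => \sum_(i < m | j i == k) c i).
under [RHS]eq_bigr do rewrite scaler_suml big_mkcond.
rewrite exchange_big; apply: eq_bigr => i _ /=.
by rewrite -big_mkcond /= (big_pred1 (j i)) ?sE // => k; rewrite eq_sym.
Qed.

Lemma lspan_range_nth (R : pzRingType) (V : lmodType R) (t : seq V) :
  lspan [set` t] = lspan (range (fun i : 'I_(size t) => t`_i)).
Proof.
apply/seteqP; split; apply: lspan_sub => v /=.
  by move=> /(nthP 0)[i lt_i <-]; apply: lspan_gen; exists (Ordinal lt_i).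
by move=> [i _ <-]; apply: lspan_gen; rewrite /= mem_nth.
Qed.

(** A row vector killing the matrix of coefficients of [u] in [v] is a linear relation among the
    [u i], hence zero; so the matrix has rank m. *)
Lemma lin_indep_leq (K : fieldType) (V : lmodType K) m n
    (u : 'I_m -> V) (v : 'I_n -> V) :
  lin_indep u -> (forall i, lspan (range v) (u i)) -> (m <= n)%N.
Proof.
move=> u_free uv; have [c uE] := boolp.choice (fun i => lspan_range (uv i)).
pose C : 'M[K]_(m, n) := \matrix_(i, j) c i j.
suff /eqP <- : row_free C by exact: rank_leq_col.
apply: inj_row_free => w wC; apply/rowP => i; rewrite mxE.
apply: (u_free (fun i => w 0 i)); under eq_bigr do rewrite uE scaler_sumr.
rewrite exchange_big big1 //= => j _; under eq_bigr do rewrite scalerA.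
rewrite -scaler_suml; have := congr1 (fun A : 'rV_n => A 0 j) wC.
rewrite !mxE; under eq_bigr do rewrite mxE; move=> ->; exact: scale0r.
Qed.

(** A vector occurring in a nontrivial relation can be discarded without changing the span. *)
Lemma fin_dim_lspan_range (K : fieldType) (V : lmodType K) n (v : 'I_n -> V) :
  fin_dim_space (lspan (range v)).
Proof.
elim: n => [|n IHn] in v *; first by exists 0%N, v; split=> // c _ [].
have [v_free|] := pselect (lin_indep v); first by exists n.+1, v.
move=> /existsNP[c] /not_implyP[cv] /existsNP[i /eqP ci].
suff -> : lspan (range v) = lspan (range (v \o fintype.lift i)) by exact: IHn.
apply/seteqP; split; apply: lspan_sub => _ [j _ <-]; last first.
  by apply: lspan_gen; exists (fintype.lift i j).
have [k ->|->] := fintype.unliftP i j; first by apply: lspan_gen; exists k.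
have -> : v i = - (c i)^-1 *: \sum_(k | k != i) c k *: v k.
  have /(congr1 ( *:%R (c i)^-1)) := cv; rewrite (bigD1 i) //= scaler0 scalerDr.
  by rewrite scalerA mulVf // scale1r => /eqP; rewrite addr_eq0 scaleNr => /eqP.
apply: lspanZ; elim/big_ind: _ => [|u w|k]; [exact: lspan0|exact: lspanD|].
case: (fintype.unliftP i k) => [k' -> _|->/eqP//].
by apply/lspanZ/lspan_gen; exists k'.
Qed.

Lemma ldim_leq (K : fieldType) (V : lmodType K) (W : set V) (t : seq V) :
  W `<=` lspan [set` t] -> (ldim W <= size t)%N.
Proof.
(* Without a basis of [W], the default value 0 makes the bound trivial. *)
move=> Wt; rewrite /ldim; case: xgetP => [n _ [v [v_free WE]]|//].
apply: (lin_indep_leq (v := fun i : 'I_(size t) => t`_i) v_free) => i.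
rewrite -lspan_range_nth; apply: Wt.
by rewrite WE; apply: lspan_gen; exists i.
Qed.

Lemma ldim_basis (K : fieldType) (V : lmodType K) (W : set V) :
  fin_dim_space W -> exists t : seq V, size t = ldim W /\ W = lspan [set` t].
Proof.
move=> Wfd; have [v [_ WE]] := xgetPex 0%N Wfd; exists (codom v).
rewrite size_codom card_ord; split=> //; rewrite {1}WE; congr lspan.
apply/seteqP; split=> w /=; first by case=> i _ <-; exact: codom_f.
by case/codomP=> i ->; exists i.
Qed.

(** Finitely many elements of an exhausted increasing filtration lie in a common step; this produces
    the constants c and d. *)
Lemma uniform_bound (T : eqType) (P : nat -> T -> Prop) (s : seq T) :
  (forall i j t, (i <= j)%N -> P i t -> P j t) ->
  (forall t, exists i, P i t) -> exists i, forall t, t \in s -> P i t.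
Proof.
move=> Pmono Pex; elim: s => [|t s [i IHs]]; first by exists 0%N.
have [j Pj] := Pex t; exists (maxn i j) => u /predU1P[->|/IHs].
  by apply: Pmono Pj; rewrite leq_maxr.
by apply: Pmono; rewrite leq_maxl.
Qed.

(** * The filtrations of an algebra and of a module *)

Section Filtration.
Variables (K : fieldType) (A : kalgType K) (a : seq A).

Lemma mulr_lspan (S T : set (kalg_space A)) (x : A) :
  (forall y : A, S y -> lspan T (x * y)) ->
  forall y : A, lspan S y -> lspan T (x * y).
Proof.
move=> ST; apply: (@lspan_morph K (kalg_space A) (kalg_space A)
  (fun y : A => x * y)) => // [y z|k y]; first exact: mulrDr.
change (x * (kalg_map A k * y) = kalg_map A k * (x * y)).
by rewrite !mulrA kalg_central.
Qed.

Lemma lspan_mulr (S T : set (kalg_space A)) (y : A) :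
  (forall x : A, S x -> lspan T (x * y)) ->
  forall x : A, lspan S x -> lspan T (x * y).
Proof.
move=> ST; apply: (@lspan_morph K (kalg_space A) (kalg_space A)
  (fun x : A => x * y)) => // [x z|k x]; first exact: mulrDl.
by change (kalg_map A k * x * y = kalg_map A k * (x * y)); rewrite mulrA.
Qed.

Lemma filt1_one : filt1 a (1 : A).
Proof. by apply: lspan_gen; left. Qed.

Lemma filtS i (x y : A) : filt1 a x -> filt a i y -> filt a i.+1 (x * y).
Proof. by move=> ax ay; apply: lspan_gen; exists x, y. Qed.

Lemma filt_span i : exists S, filt a i = lspan S.
Proof. by case: i => [|i]; eexists. Qed.

Lemma filt_one i : filt a i (1 : A).
Proof.
elim: i => [|i IHi]; first exact: lspan_gen.
by rewrite -[1 : A]mulr1; apply: filtS; first exact: filt1_one.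
Qed.

Lemma filt_mul i j (x y : A) :
  filt a i x -> filt a j y -> filt a (i + j) (x * y).
Proof.
elim: i x => [|i IHi] x.
  have [S ->] := filt_span j => ax ay; move: x ax.
  by apply: lspan_mulr => _ ->; rewrite mul1r.
move=> ax ay; move: x ax; apply: lspan_mulr => _ [u [v [au av ->]]].
by rewrite -mulrA; apply: filtS => //; exact: IHi.
Qed.

Lemma filt_mono i j (x : A) : (i <= j)%N -> filt a i x -> filt a j x.
Proof.
move=> le_ij ax; rewrite -(subnKC le_ij) -[x]mulr1.
by apply: filt_mul => //; exact: filt_one.
Qed.

Lemma filtB i (x y : A) : filt a i x -> filt a i y -> filt a i (x - y).
Proof.
have [S ->] := filt_span i.
exact: (@lspanB K (kalg_space A)).
Qed.

(** The union of the A_i is a subalgebra containing K and the generators. *)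
Lemma filt_exhaust : alg_generated_by a -> forall x : A, exists i, filt a i x.
Proof.
move=> gen_a; suff SE : [set x : A | exists i, filt a i x] = setT.
  by move=> x; have : [set: A] x by []; rewrite -SE.
apply: gen_a => [k|x y [i ax] [j ay]|x y [i ax] [j ay]|x ax].
- exists 0%N; rewrite -[kalg_map A k]mulr1.
  by apply: (@lspanZ K (kalg_space A)); exact: lspan_gen.
- exists (maxn i j); apply: filtB; [apply: filt_mono ax|apply: filt_mono ay].
    by rewrite leq_maxl.
  by rewrite leq_maxr.
- by exists (i + j)%N; exact: filt_mul.
- by exists 1%N; rewrite -[x]mulr1; apply: filtS; apply: lspan_gen => //; right.
Qed.

Lemma filtSE i : filt a i.+1 = lspan [set z : kalg_space A |
  exists x y, [/\ filt1 a x, filt a i y & z = (x : A) * (y : A)]].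
Proof. by []. Qed.

(** The words of length i in 1 and the generators span A_i. *)
Lemma filt_fin i :
  exists s : seq A, filt a i = lspan ([set` s] : set (kalg_space A)).
Proof.
elim: i => [|i [s IHi]].
  exists [:: 1]; congr lspan.
  by apply/seteqP; split=> x /=; rewrite inE => /eqP.
exists [seq x * y | x <- 1 :: a, y <- s]; rewrite filtSE IHi; apply/seteqP.
split; apply: (@lspan_sub K (kalg_space A)) => z; last first.
  move=> /allpairsP[[x y] /= [ax sy ->]]; apply: lspan_gen.
  exists x, y; split=> //.
    by apply: lspan_gen; move: ax; rewrite inE => /predU1P.
  exact: lspan_gen.
move=> [x [y [ax ay ->]]]; move: y ay; apply: mulr_lspan => y sy.
move: x ax; apply: lspan_mulr => x ax.
apply: lspan_gen; apply/allpairsP; exists (x, y); split=> //=.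
by rewrite inE; apply/predU1P.
Qed.

Variable M : lmodType A.
Implicit Types m : M.

Lemma lspan_scale (S : set (kalg_space A)) (T : set (restrict_scalars M)) m :
  (forall x : A, S x -> lspan T (x *: m)) ->
  forall x : A, lspan S x -> lspan T (x *: m).
Proof.
move=> ST; apply: (@lspan_morph K (kalg_space A) (restrict_scalars M)
  (fun x : A => x *: m)) => // [x z|k x].
  exact: (@scalerDl A M m x z).
exact: esym (@scalerA A M (kalg_map A k) x m).
Qed.

Lemma scale_lspan (S T : set (restrict_scalars M)) (x : A) :
  (forall m, S m -> lspan T (x *: m)) ->
  forall m, lspan S m -> lspan T (x *: m).
Proof.
move=> ST; apply: (@lspan_morph K (restrict_scalars M) (restrict_scalars M)
  (fun m : M => x *: m)) => // [m n|k m].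
  exact: (@scalerDr A M x m n).
change (x *: (kalg_map A k *: m) = kalg_map A k *: (x *: m)).
by rewrite !scalerA kalg_central.
Qed.

Lemma mod_filt_scale (M0 : set (restrict_scalars M)) i j (x : A) m :
  filt a i x -> mod_filt a M0 j m -> mod_filt a M0 (i + j) (x *: m).
Proof.
move=> ax; move: m; apply: scale_lspan => _ [y [m [ay Mm ->]]].
rewrite scalerA; apply: lspan_gen; exists (x * y), m; split=> //.
exact: filt_mul.
Qed.

Lemma mod_filt_mono (M0 : set (restrict_scalars M)) i j m :
  (i <= j)%N -> mod_filt a M0 i m -> mod_filt a M0 j m.
Proof.
move=> le_ij Mm; rewrite -(subnK le_ij) -[m]scale1r.
by apply: mod_filt_scale => //; exact: filt_one.
Qed.

Lemma mod_filt_exhaust (M0 : set (restrict_scalars M)) :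
  alg_generated_by a -> lspan (M0 : set M) = setT ->
  forall m, exists i, mod_filt a M0 i m.
Proof.
move=> gen_a gen_M0 m; have : lspan (M0 : set M) m by rewrite gen_M0.
case=> n [c [s [Ms ->]]].
have [i ci] : exists i, forall x, x \in codom c -> filt a i x.
  by apply: uniform_bound; [exact: filt_mono|exact: filt_exhaust].
exists i; apply: (@lspan_sum K (restrict_scalars M)) => j.
by apply: lspan_gen; exists (c j), (s j); split=> //; apply: ci; exact: codom_f.
Qed.

(** Guarantees that [ldim] of M_i is a true dimension and not its default value. *)
Lemma mod_filt_fin_dim (M0 : set (restrict_scalars M)) i :
  fin_dim_space M0 -> fin_dim_space (mod_filt a M0 i).
Proof.
move=> /ldim_basis[t [_ M0E]]; have [s sE] := filt_fin i.
suff -> : mod_filt a M0 i =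
    lspan ([set` [seq x *: (m : M) | x <- s, m <- t]] :
           set (restrict_scalars M)).
  by rewrite lspan_range_nth; exact: fin_dim_lspan_range.
apply/seteqP; split; apply: (@lspan_sub K (restrict_scalars M)) => z;
  last first.
  move=> /allpairsP[[x m] /= [sx tm ->]]; apply: lspan_gen.
  exists x, m; split=> //.
    by rewrite sE; exact: lspan_gen.
  by rewrite M0E; exact: lspan_gen.
move=> [x [m [ax Mm ->]]]; rewrite sE in ax; rewrite M0E in Mm.
move: m Mm; apply: scale_lspan => m tm; move: x ax; apply: lspan_scale => x sx.
by apply: lspan_gen; apply/allpairsP; exists (x, m).
Qed.

End Filtration.

(** * Transfer of filtrations along a Morita context *)

(* A left module over the Morita ring, split into its two components; unlike  *)
(* the pair (M, Y (x) M), this notion is symmetric in A and B.                *)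
Record morita_pair (K : fieldType) (A B : kalgType K) (X : bimodType A B)
    (Y : bimodType B A) (C : morita_context X Y)
    (M : lmodType A) (N : lmodType B) := MoritaPair {
  actY : Y -> M -> N;
  actX : X -> N -> M;
  actYD : forall y m m', actY y (m + m') = actY y m + actY y m';
  actXD : forall x n n', actX x (n + n') = actX x n + actX x n';
  actY_bal : forall y a m, actY (rscale y a) m = actY y (a *: m);
  actX_bal : forall x b n, actX (rscale x b) n = actX x (b *: n);
  actY_l : forall b y m, actY (b *: y) m = b *: actY y m;
  actX_l : forall a x n, actX (a *: x) n = a *: actX x n;
  actXY : forall x y m, actX x (actY y m) = mcXY C x y *: m;
  actYX : forall y x n, actY y (actX x n) = mcYX C y x *: n
}.

Definition morita_context_sym (K : fieldType) (A B : kalgType K)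
    (X : bimodType A B) (Y : bimodType B A) (C : morita_context X Y) :
    morita_context Y X :=
  MoritaContext (mcYXDl C) (mcYXDr C) (mcYX_bal C) (mcYX_l C) (mcYX_r C)
    (mcXYDl C) (mcXYDr C) (mcXY_bal C) (mcXY_l C) (mcXY_r C)
    (mcYXY C) (mcXYX C).

Definition morita_pair_sym (K : fieldType) (A B : kalgType K)
    (X : bimodType A B) (Y : bimodType B A) (C : morita_context X Y)
    (M : lmodType A) (N : lmodType B) (P : morita_pair C M N) :
    morita_pair (morita_context_sym C) N M :=
  @MoritaPair _ _ _ _ _ (morita_context_sym C) _ _ _ _ (actXD P) (actYD P)
    (actX_bal P) (actY_bal P) (actX_l P) (actY_l P) (actYX P) (actXY P).

Section MoritaPair.
Variables (K : fieldType) (A B : kalgType K) (X : bimodType A B).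
Variables (Y : bimodType B A) (C : morita_context X Y).
Variables (M : lmodType A) (N : lmodType B) (P : morita_pair C M N).
Implicit Types (x : X) (y : Y) (m : M) (n : N).

Lemma actY0 y : actY P y 0 = 0.
Proof. by apply: (addIr (actY P y 0)); rewrite -actYD !add0r. Qed.

Lemma actYK y (k : K) m :
  actY P y (kalg_map A k *: m) = kalg_map B k *: actY P y m.
Proof. by rewrite -actY_bal lrscaleK actY_l. Qed.

Lemma actXK x (k : K) n :
  actX P x (kalg_map B k *: n) = kalg_map A k *: actX P x n.
Proof. by rewrite -actX_bal lrscaleK actX_l. Qed.

Lemma unit_decomp_sum (s : seq (X * Y)) m :
  1 = \sum_(p <- s) mcXY C p.1 p.2 ->
  m = \sum_(p <- s) actX P p.1 (actY P p.2 m).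
Proof.
move=> sE; rewrite -[LHS]scale1r sE scaler_suml.
by apply: eq_bigr => p _; rewrite actXY.
Qed.

(** Since y = y 1 = sum_p (y x_p) y_p, the elements y_p generate Y over B. *)
Lemma actY_decomp (s : seq (X * Y)) y m :
  1 = \sum_(p <- s) mcXY C p.1 p.2 ->
  actY P y m = \sum_(p <- s) mcYX C y p.1 *: actY P p.2 m.
Proof.
move=> /(unit_decomp_sum m) mE; rewrite {1}mE.
rewrite (big_morph _ (actYD P y) (actY0 y)).
by apply: eq_bigr => p _; rewrite actYX.
Qed.

(** The map u |-> (y u) x is K-linear because K acts alike on both sides of the bimodules, so 1 and
    the generators suffice. *)
Lemma mcYX_lspan (a : seq A) (b : seq B) (c : nat) y x :
  (forall u : A, u \in 1 :: a -> filt b c (mcYX C (rscale y u) x)) ->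
  forall u : A, filt1 a u -> filt b c (mcYX C (rscale y u) x).
Proof.
have [S ->] := filt_span b c => ac.
apply: (@lspan_morph K (kalg_space A) (kalg_space B)
  (fun u : A => mcYX C (rscale y u) x)) => [u v|k u|u au].
- by rewrite rscaleDr mcYXDl.
- change (mcYX C (rscale y (kalg_map A k * (u : A))) x =
    kalg_map B k * mcYX C (rscale y u) x).
  by rewrite -rscaleA lrscaleK lrscaleA mcYX_l.
- by apply: ac; rewrite inE; apply/predU1P.
Qed.

Lemma actY_lspan (S : set (restrict_scalars M))
    (T : set (restrict_scalars N)) y :
  (forall m, S m -> lspan T (actY P y m)) ->
  forall m, lspan S m -> lspan T (actY P y m).
Proof.
apply: (@lspan_morph K (restrict_scalars M) (restrict_scalars N) (actY P y)).
  exact: actYD.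
exact: actYK.
Qed.

Lemma actX_lspan (S : set (restrict_scalars N))
    (T : set (restrict_scalars M)) x :
  (forall n, S n -> lspan T (actX P x n)) ->
  forall n, lspan S n -> lspan T (actX P x n).
Proof.
apply: (@lspan_morph K (restrict_scalars N) (restrict_scalars M) (actX P x)).
  exact: actXD.
exact: actXK.
Qed.

(* If Y_0 is spanned by the p.2 with p in s, then Y_0 A_1 lies in B_c Y_0 and *)
(* hence Y_0 A_i in B_(c i) Y_0.                                              *)
Lemma actY_filt (a : seq A) (b : seq B) (N0 : set (restrict_scalars N))
    (s : seq (X * Y)) (c j : nat) m :
  1 = \sum_(p <- s) mcXY C p.1 p.2 ->
  (forall p q u, p \in s -> q \in s -> u \in 1 :: a ->
     filt b c (mcYX C (rscale p.2 u) q.1)) ->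
  (forall p, p \in s -> mod_filt b N0 j (actY P p.2 m)) ->
  forall i (u : A) p, filt a i u -> p \in s ->
    mod_filt b N0 (c * i + j) (actY P p.2 (u *: m)).
Proof.
move=> sE bc Nj; elim=> [|i IHi] u p au ps.
  (* A_0 = K, and scalars pass through the action of Y. *)
  rewrite muln0 add0n -actY_bal; move: u au.
  apply: (@lspan_morph K (kalg_space A) (restrict_scalars N)
    (fun u : A => actY P (rscale p.2 u) m)) => [u v|k u|u ->].
  - by rewrite /= !actY_bal -actYD -(@scalerDl A M m u v).
  - change (actY P (rscale p.2 (kalg_map A k * (u : A))) m =
      kalg_map B k *: actY P (rscale p.2 u) m).
    by rewrite !actY_bal -scalerA actYK.
  - by rewrite rscale1; exact: Nj.
rewrite -actY_bal; move: u au.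
apply: (@lspan_morph K (kalg_space A) (restrict_scalars N)
    (fun u : A => actY P (rscale p.2 u) m)) => [u v|k u|_ [u [v [au av ->]]]].
- by rewrite /= !actY_bal -actYD -(@scalerDl A M m u v).
- change (actY P (rscale p.2 (kalg_map A k * (u : A))) m =
    kalg_map B k *: actY P (rscale p.2 u) m).
  by rewrite !actY_bal -scalerA actYK.
(* For u in A_1 and v in A_i, y_p u v m = sum_q (y_p u x_q) (y_q v m): the coefficient lies in B_c
   and the induction hypothesis bounds the rest. *)
rewrite -rscaleA actY_bal (actY_decomp _ _ sE) big_seq.
elim/big_ind: _ => [|n n'|q qs]; first exact: lspan0.
  exact: (@lspanD K (restrict_scalars N)).
rewrite mulnS -addnA; apply: mod_filt_scale; last exact: IHi.
by apply: mcYX_lspan au => w aw; exact: bc.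
Qed.

Lemma is_GKdim_le (R : realType) g h :
  imXY C = setT -> is_GKdim (R := R) M g -> is_GKdim (R := R) N h ->
  (g <= h)%E.
Proof.
move=> XY1 [a [M0 [gen_a fdM0 gen_M0 ->]]] [b [N0 [gen_b fdN0 gen_N0 ->]]].
have [s sE] : imXY C 1 by rewrite XY1.
(* c bounds the degrees of the finitely many y_p u x_q with u equal to 1 or a generator. *)
have [c bc] : exists c, forall z, z \in
    [seq mcYX C (rscale pq.1.2 u) pq.2.1 | pq <- [seq (p, q) | p <- s, q <- s],
       u <- 1 :: a] -> filt b c z.
  by apply: uniform_bound; [exact: filt_mono|exact: filt_exhaust].
have [t [_ M0E]] := ldim_basis fdM0.
(* d bounds the degrees of the finitely many y_p m with m in a basis of M_0. *)
have [d bd] : exists d, forall n, n \in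
    [seq actY P p.2 (m : M) | p <- s, m <- t] -> mod_filt b N0 d n.
  by apply: uniform_bound; [exact: mod_filt_mono|exact: mod_filt_exhaust].
(* The slope is c + 1 rather than c because [growth_le_affine] asks for a positive one. *)
have sM i p m : p \in s -> mod_filt a M0 i m ->
    mod_filt b N0 (c.+1 * i + d) (actY P p.2 m).
  move=> ps; move: m; apply: actY_lspan => _ [u [m [au Mm ->]]].
  apply: (actY_filt sE) au ps => //.
    move=> p1 q v p1s qs av; apply: (@filt_mono _ _ _ c) => //; apply: bc.
    apply/allpairsP; exists ((p1, q), v); split=> //.
    by apply/allpairsP; exists (p1, q).
  move=> q qs; rewrite M0E in Mm; move: m Mm; apply: actY_lspan => m tm.
  by apply: bd; apply/allpairsP; exists (q, m).
apply: (@growth_le_affine _ _ _ (size s) c.+1 d) => // i.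
have [e [<- NE]] := ldim_basis (mod_filt_fin_dim b (c.+1 * i + d) fdN0).
(* M_i lies in the sum of the x_p N_((c+1) i + d), which is spanned by the x_p n with n in a basis
   of N_((c+1) i + d). *)
rewrite -(size_allpairs (fun p (n : N) => actX P p.1 n) s e).
apply: ldim_leq => m Mm; rewrite (unit_decomp_sum m sE) big_seq.
elim/big_ind: _ => [|n n'|p ps]; first exact: lspan0.
  exact: (@lspanD K (restrict_scalars M)).
have := sM _ _ _ ps Mm; rewrite NE; move: (actY _ _ _).
apply: actX_lspan => n en; apply: lspan_gen; apply/allpairsP.
by exists (p, n).
Qed.

(** Writing n = sum_q y_q (x_q n) and expanding x_q n in the generators t_j of M leaves terms (y_q
    a) t_j, which [actY_decomp] puts in the B-span of the y_p t_j. *)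
Lemma morita_pair_fg : morita_equivalence C -> fg_module M -> fg_module N.
Proof.
move=> [XY1 YX1] [t tE].
have [s sE] : imXY C 1 by rewrite XY1.
have [r rE] : imYX C 1 by rewrite YX1.
exists [seq actY P p.2 m | p <- s, m <- t]; apply/seteqP; split=> // n _.
rewrite -[n]scale1r rE scaler_suml; elim/big_ind: _ => [|u v|q _].
- exact: lspan0.
- exact: lspanD.
rewrite -(actYX P); have : lspan [set` t] (actX P q.2 n) by rewrite tE.
move=> [k [c [v [tv ->]]]]; rewrite (big_morph _ (actYD P q.1) (actY0 q.1)).
apply: lspan_sum => i; rewrite -actY_bal (actY_decomp _ _ sE) big_seq.
elim/big_ind: _ => [|u w|p ps]; [exact: lspan0|exact: lspanD|].
apply/lspanZ/lspan_gen; apply/allpairsP; exists (p, v i); split=> //.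
exact: tv.
Qed.

End MoritaPair.

(** * Equality of dimensions for a Morita pair *)

Lemma is_GKdim_ex (R : realType) (K : fieldType) (A : kalgType K)
    (M : lmodType A) :
  fg_algebra A -> fg_module M -> exists g, is_GKdim (R := R) M g.
Proof.
move=> [a gen_a] [t tE]; pose M0 : set (restrict_scalars M) :=
  lspan ([set` t] : set (restrict_scalars M)).
exists (growth R (fun i => ldim (mod_filt a M0 i))), a, M0; split=> //.
  by rewrite /M0 lspan_range_nth; exact: fin_dim_lspan_range.
apply/seteqP; split=> // m _; have : lspan [set` t] m by rewrite tE.
by apply: lspan_sub => {}m tm; apply: lspan_gen; exact: lspan_gen.
Qed.

Lemma GKdim_morita_pair (R : realType) (K : fieldType) (A B : kalgType K)
    (X : bimodType A B) (Y : bimodType B A) (C : morita_context X Y)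
    (M : lmodType A) (N : lmodType B) (P : morita_pair C M N) :
  fg_algebra A -> fg_algebra B -> morita_equivalence C -> fg_module M ->
  GKdim R M = GKdim R N.
Proof.
move=> fgA fgB equivC fgM; have fgN := morita_pair_fg P equivC fgM.
have [XY1 YX1] := equivC.
have gM := xgetPex +oo%E (is_GKdim_ex R fgA fgM).
have gN := xgetPex +oo%E (is_GKdim_ex R fgB fgN).
apply: le_anti; rewrite (is_GKdim_le P XY1 gM gN) /=.
exact: (is_GKdim_le (morita_pair_sym P) YX1 gN gM).
Qed.

(** * The Morita pair formed by M and Y (x) M *)

Section TensorPair.
Variables (K : fieldType) (A B : kalgType K) (X : bimodType A B).
Variables (Y : bimodType B A) (C : morita_context X Y) (M : lmodType A).
Implicit Types (x : X) (y : Y) (m : M) (t : tensor Y M).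

(** [zmodule M] is M viewed as a module over the integers, as the universal property of the free
    abelian group requires. *)
Definition free_actX x : free_tens Y M -> zmodule M :=
  fglift (fun p : Y * M => mcXY C x p.1 *: p.2 : zmodule M).

Lemma free_actXB x : {morph free_actX x : D E / D - E}.
Proof. exact: lift_is_additive. Qed.

Lemma free_actX_gen x y m : free_actX x (gen_tens y m) = mcXY C x y *: m.
Proof. by rewrite /free_actX /gen_tens liftU scale1r. Qed.

Lemma free_actX0 x : free_actX x 0 = 0.
Proof. by rewrite -[X in free_actX x X](subrr 0) free_actXB subrr. Qed.

Lemma free_actXD x : {morph free_actX x : D E / D + E}.
Proof.
move=> D E; have N0 F : free_actX x (- F) = - free_actX x F.
  by rewrite -sub0r free_actXB free_actX0 sub0r.
by rewrite -[X in free_actX x (_ + X)]opprK free_actXB N0 opprK.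
Qed.

Lemma free_actXZ x (k : int) D : free_actX x (k *: D) = k *: free_actX x D.
Proof.
have MnE n : free_actX x (D *+ n) = free_actX x D *+ n.
  elim: n => [|n IHn]; first by rewrite free_actX0.
  by rewrite !mulrSr free_actXD IHn.
case: k => n; first by rewrite -[Posz n]natz !scaler_nat MnE.
rewrite NegzE !scaleNr -[Posz _]natz !scaler_nat -MnE.
by rewrite -[X in free_actX x X]sub0r free_actXB free_actX0 sub0r.
Qed.

(** The three kinds of relators vanish by additivity in y, additivity in m and right A-linearity of
    [mcXY]; hence the action descends to the tensor product. *)
Lemma free_actX_rel x D :
  lspan (@tens_relator _ _ _ Y M) D -> free_actX x D = 0.
Proof.
move=> [n [c [s [Rs ->]]]].
rewrite (big_morph _ (free_actXD x) (free_actX0 x)) big1 // => i _.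
rewrite free_actXZ; set z := free_actX x (s i).
suff -> : z = 0 by rewrite scaler0.
rewrite {}/z; have [[y [y' [m ->]]]|[y [m [m' ->]]]|[y [a [m ->]]]] := Rs i;
  rewrite !free_actXB !free_actX_gen.
- by rewrite mcXYDr scalerDl addrAC addrK subrr.
- by rewrite scalerDr addrAC addrK subrr.
- by rewrite mcXY_r scalerA subrr.
Qed.

Definition tensor_actX x t : M := free_actX x (repr t).

Lemma tensor_actX_proj x D : tensor_actX x (tens_proj D) = free_actX x D.
Proof.
apply/eqP; rewrite -subr_eq0 -[X in X == _](free_actXB x); apply/eqP.
by apply: free_actX_rel; apply/tens_proj_eq; rewrite tens_proj_repr.
Qed.

Lemma tensor_actXD x t u :
  tensor_actX x (t + u) = tensor_actX x t + tensor_actX x u.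
Proof.
elim/tensorP: t => D; elim/tensorP: u => E.
by rewrite -tens_projD !tensor_actX_proj free_actXD.
Qed.

Lemma tensor_actX0 x : tensor_actX x 0 = 0.
Proof. by apply: (addIr (tensor_actX x 0)); rewrite -tensor_actXD !add0r. Qed.

Lemma tensor_actXB x t u :
  tensor_actX x (t - u) = tensor_actX x t - tensor_actX x u.
Proof. by apply/eqP; rewrite eq_sym subr_eq -tensor_actXD subrK. Qed.

Lemma tensor_actX_tens x y m : tensor_actX x (tens y m) = mcXY C x y *: m.
Proof. by rewrite tensor_actX_proj free_actX_gen. Qed.

Lemma tens_scale b y m : b *: tens y m = tens (b *: y) m.
Proof. exact: tensor_scale_tens. Qed.

Lemma tensor_actX_bal x b t :
  tensor_actX (rscale x b) t = tensor_actX x (b *: t).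
Proof.
elim/tens_ind: t => [|y m|t u IHt IHu]; first by rewrite scaler0 !tensor_actX0.
  by rewrite tens_scale !tensor_actX_tens mcXY_bal.
by rewrite scalerBr !tensor_actXB IHt IHu.
Qed.

Lemma tensor_actX_l a x t : tensor_actX (a *: x) t = a *: tensor_actX x t.
Proof.
elim/tens_ind: t => [|y m|t u IHt IHu]; first by rewrite !tensor_actX0 scaler0.
  by rewrite !tensor_actX_tens mcXY_l scalerA.
by rewrite !tensor_actXB IHt IHu scalerBr.
Qed.

(** On generators, y (x) (x y') m = y (x y') (x) m = (y x) y' (x) m, by balancing and the
    associativity [mcYXY]. *)
Lemma tens_tensor_actX y x t : tens y (tensor_actX x t) = mcYX C y x *: t.
Proof.
have tens0 : tens y (0 : M) = 0.
  by apply: (addIr (tens y 0)); rewrite -tensDr !add0r.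
have tensB m m' : tens y (m - m') = tens y m - tens y m'.
  by apply/eqP; rewrite eq_sym subr_eq -tensDr subrK.
elim/tens_ind: t => [|y' m|t u IHt IHu].
- by rewrite tensor_actX0 tens0 scaler0.
- by rewrite tensor_actX_tens -tens_balanced -mcYXY tens_scale.
- by rewrite tensor_actXB tensB IHt IHu scalerBr.
Qed.

Definition tensor_pair : morita_pair C M (tensor Y M) :=
  MoritaPair (@tensDr _ _ _ Y M) tensor_actXD (@tens_balanced _ _ _ Y M)
    tensor_actX_bal (fun b y m => esym (tens_scale b y m)) tensor_actX_l
    tensor_actX_tens tens_tensor_actX.

End TensorPair.

Theorem theorem1p7 (R : realType) (K : fieldType) (A B : kalgType K)
    (fgA : fg_algebra A) (fgB : fg_algebra B)
    (X : bimodType A B) (Y : bimodType B A) (C : morita_context X Y)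
    (equivC : morita_equivalence C)
    (M : lmodType A) (fgM : fg_module M) :
  GKdim R M = GKdim R (tensor Y M).
Proof. exact: (GKdim_morita_pair R (tensor_pair C M)). Qed.
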